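(* Let $A$ and $A'$ be symmetrizable weak generalized Cartan matrices of size $r$ that have a common symmetrizer $D$. Let $N=(n_{ab})_{a,b\in[1,r]}:=2I_r-A$ and $N'=(n'_{ab})_{a,b\in[1,r]}:=2I_r-A'$. Then the triple $\alpha=(A_+,A_-,D)$ with $A_\pm=N_0-N_\pm$ defined by $$N_0=(1+z^2)I_r,\qquad N_+=zN,\qquad N_-=zN'$$ is a T-datum if and only if $AA'=A'A$ and $n_{ab}n'_{ab}=0$ for any $a,b\in[1,r]$.
   Context: Notation: $[1,r]=\{1,\dots,r\}$; $I_r$ is the identity matrix; $\mathfrak{S}_r$ is the group of permutations of $[1,r]$; $\delta$ is the Kronecker delta. For a square matrix $A$ with entries in $\mathbb{Z}[z^{\pm1}]$, $A^\dagger:=(A|_{z=z^{-1}})^{\mathsf T}$. A matrix $C=(c_{ab})\in\mathrm{Mat}_{r\times r}(\mathbb{Z})$ is a symmetrizable weak generalized Cartan matrix if (1) $c_{aa}\le2$ for any $a$; (2) $c_{ab}\le0$ for any $a\ne b$; (3) there is a positive integer diagonal matrix $D$ (a symmetrizer of $C$) such that $CD$ is symmetric. T-datum: consider triples $(N_0,N_+,N_-)$ of matrices in $\mathrm{Mat}_{r\times r}(\mathbb{Z}[z])$, $N_\varepsilon=(\sum_{p\ge0}n^\varepsilon_{ab;p}z^p)_{a,b\in[1,r]}$, satisfying (N1) $n^0_{ab;p}=\delta_{ab}\delta_{p0}+\delta_{a\sigma(b)}\delta_{pp_a}$ for some $\sigma\in\mathfrak{S}_r$ and $p_a\in\mathbb{Z}_{>0}$;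 (N2) $n^\pm_{ab;p}\ge0$ for all $a,b,p$; (N3) $n^\pm_{ab;p}=0$ unless $0<p<p_a$; (N4) $n^+_{ab;p}n^-_{ab;p}=0$ for all $a,b,p$. A T-datum of size $r$ is a triple $(A_+,A_-,D)$ such that $A_\pm=N_0-N_\pm$ for some $(N_0,N_+,N_-)$ satisfying (N1)-(N4) and $D$ is a positive integer diagonal matrix with $N_0D=DN_0$, $D^{-1}N_\pm D\in\mathrm{Mat}_{r\times r}(\mathbb{Z}[z])$, and $A_+DA_-^\dagger=A_-DA_+^\dagger$. *)

(* Defs.v *)
From HB Require Import structures.
From mathcomp Require Import all_boot all_order all_fingroup all_algebra.

Set Implicit Arguments.
Unset Strict Implicit.
Unset Printing Implicit Defensive.

Import Order.TTheory GRing.Theory Num.Theory.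

Local Open Scope ring_scope.
Local Open Scope quotient_scope.

Definition positive_diagonal (r : nat) (D : 'M[int]_r) : Prop :=
  is_diag_mx D /\ forall a : 'I_r, 0 < D a a.

Definition symmetrizer (r : nat) (C D : 'M[int]_r) : Prop :=
  positive_diagonal D /\ (C *m D)^T = C *m D.

Definition symmetrizable_weak_GCM (r : nat) (C : 'M[int]_r) : Prop :=
  [/\ forall a : 'I_r, C a a <= 2,
      forall a b : 'I_r, a != b -> C a b <= 0
    & exists D : 'M[int]_r, symmetrizer C D].

(* The Laurent polynomial ring Z[z, z^-1] is handled inside the field Q(z), of
   which it is a subring; Q(z) also contains the entries of D^-1 N D. The
   variable z is 'X in {poly int}, and tofrac 'X in Q(z). *)
Notation Qz := {fraction {poly int}}.

Definition zvar : Qz := tofrac 'X.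

(* p|_{z = f}, for p in Z[z] *)
Definition eval_at (f : Qz) (p : {poly int}) : Qz :=
  (map_poly (fun c : int => c%:~R : Qz) p).[f].

(* The substitution z |-> z^-1 on Q(z), computed on a representative fraction;
   subst_zV_frac shows that the choice of representative is irrelevant, and
   subst_zV_laurent gives the values on Z[z, z^-1]. *)
Definition subst_zV (f : Qz) : Qz :=
  eval_at zvar^-1 (frac (generic_quotient.repr f)).1 /
  eval_at zvar^-1 (frac (generic_quotient.repr f)).2.

Definition dagger (r : nat) (A : 'M[Qz]_r) : 'M[Qz]_r := (map_mx subst_zV A)^T.

Definition mx_of_poly (r : nat) (A : 'M[{poly int}]_r) : 'M[Qz]_r :=
  map_mx (@tofrac {poly int}) A.

Definition polymx_of_int (r : nat) (D : 'M[int]_r) : 'M[{poly int}]_r :=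
  map_mx polyC D.

Definition Qzmx_of_int (r : nat) (D : 'M[int]_r) : 'M[Qz]_r :=
  mx_of_poly (polymx_of_int D).

Definition has_poly_entries (r : nat) (M : 'M[Qz]_r) : Prop :=
  exists P : 'M[{poly int}]_r, M = mx_of_poly P.

Definition cond_N1 (r : nat) (sigma : 'S_r) (pdeg : 'I_r -> nat)
    (N0 : 'M[{poly int}]_r) : Prop :=
  (forall a : 'I_r, (0 < pdeg a)%N) /\
  forall (a b : 'I_r) (p : nat),
    (N0 a b)`_p = (a == b)%:R * (p == 0%N)%:R
                  + (a == sigma b)%:R * (p == pdeg a)%:R.

Definition cond_N2 (r : nat) (N : 'M[{poly int}]_r) : Prop :=
  forall (a b : 'I_r) (p : nat), 0 <= (N a b)`_p.

Definition cond_N3 (r : nat) (pdeg : 'I_r -> nat)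
    (N : 'M[{poly int}]_r) : Prop :=
  forall (a b : 'I_r) (p : nat), ~~ (0 < p < pdeg a)%N -> (N a b)`_p = 0.

Definition cond_N4 (r : nat) (Np Nm : 'M[{poly int}]_r) : Prop :=
  forall (a b : 'I_r) (p : nat), (Np a b)`_p * (Nm a b)`_p = 0.

Definition conditions_N (r : nat) (N0 Np Nm : 'M[{poly int}]_r) : Prop :=
  exists (sigma : 'S_r) (pdeg : 'I_r -> nat),
    [/\ cond_N1 sigma pdeg N0,
        cond_N2 Np /\ cond_N2 Nm,
        cond_N3 pdeg Np /\ cond_N3 pdeg Nm
      & cond_N4 Np Nm].

Definition is_T_datum (r : nat)
    (alpha : 'M[{poly int}]_r * 'M[{poly int}]_r * 'M[int]_r) : Prop :=
  let: (Ap, Am, D) := alpha in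
  exists N0 Np Nm : 'M[{poly int}]_r,
    [/\ conditions_N N0 Np Nm, Ap = N0 - Np & Am = N0 - Nm] /\
    [/\ positive_diagonal D,
        N0 *m polymx_of_int D = polymx_of_int D *m N0,
        has_poly_entries
          (invmx (Qzmx_of_int D) *m mx_of_poly Np *m Qzmx_of_int D),
        has_poly_entries
          (invmx (Qzmx_of_int D) *m mx_of_poly Nm *m Qzmx_of_int D)
      & mx_of_poly Ap *m Qzmx_of_int D *m dagger (mx_of_poly Am)
        = mx_of_poly Am *m Qzmx_of_int D *m dagger (mx_of_poly Ap)].

Lemma zvar_neq0 : zvar != 0.
Proof. by rewrite tofrac_eq0 polyX_eq0. Qed.

Lemma intr_tofrac (c : int) : (c%:~R : Qz) = tofrac c%:P.
Proof. by rewrite -[c in RHS]intz !rmorph_int. Qed.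

Lemma eval_atM (f : Qz) : {morph eval_at f : p q / p * q}.
Proof. by move=> p q; rewrite /eval_at rmorphM hornerM. Qed.

Lemma eval_at_zV_neq0 (q : {poly int}) : q != 0 -> eval_at zvar^-1 q != 0.
Proof.
move=> q0; set n := (size q).-1.
have sq : size q = n.+1 by rewrite prednK // size_poly_gt0.
have E : zvar ^+ n * eval_at zvar^-1 q =
         tofrac (\sum_(i < n.+1) (q`_i)%:P * 'X^(n - i)).
  rewrite /eval_at (@horner_coef_wide _ n.+1); last first.
    by rewrite -sq size_poly.
  rewrite mulr_sumr rmorph_sum; apply: eq_bigr => i _ /=.
  rewrite coef_map_id0 // intr_tofrac tofracM tofracXn -/zvar mulrCA.
  congr (_ * _); rewrite exprVn expfB_cond ?zvar_neq0 //.
  by rewrite (negPf zvar_neq0) add0n -ltnS.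
apply/eqP => e0; move: E; rewrite e0 mulr0 => /esym/eqP.
rewrite tofrac_eq0 => /eqP/(congr1 (coefp 0)); rewrite /= coef_sum coef0.
rewrite big_ord_recr /= big1 => [|i _]; last first.
  by rewrite coefCM coefXn eq_sym subn_eq0 leqNgt ltn_ord mulr0.
rewrite subnn expr0 mulr1 coefC eqxx add0r => qn0.
by move: q0; rewrite -lead_coef_eq0 lead_coefE -/n qn0 eqxx.
Qed.

Lemma Qz_repr (f : Qz) :
  f = tofrac (frac (generic_quotient.repr f)).1 /
      tofrac (frac (generic_quotient.repr f)).2.
Proof.
set x := generic_quotient.repr f.
have dx : tofrac (frac x).2 != 0 by rewrite tofrac_eq0 denom_ratioP.
apply: (mulIf dx); rewrite divfK //.
rewrite -[f]reprK -/x !piE.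
apply/eqmodP; rewrite /= FracField.equivfE /FracField.mulf.
by rewrite !numden_Ratio ?mulf_neq0 ?oner_eq0 ?denom_ratioP // !mulr1 mulrC.
Qed.

Lemma subst_zV_frac (p q : {poly int}) : q != 0 ->
  subst_zV (tofrac p / tofrac q) = eval_at zvar^-1 p / eval_at zvar^-1 q.
Proof.
move=> q0; have fE := Qz_repr (tofrac p / tofrac q).
rewrite /subst_zV; move: (generic_quotient.repr _) fE => x fE.
have dx := denom_ratioP x.
apply/eqP; rewrite eqr_div ?eval_at_zV_neq0 // -!eval_atM.
move/eqP: fE; rewrite eqr_div ?tofrac_eq0 // -!tofracM tofrac_eq => /eqP E.
by rewrite E.
Qed.

Lemma subst_zV_poly (p : {poly int}) :
  subst_zV (tofrac p) = eval_at zvar^-1 p.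
Proof.
rewrite -[tofrac p]divr1 -tofrac1 subst_zV_frac ?oner_eq0 //.
by rewrite {2}/eval_at rmorph1 hornerC divr1.
Qed.

Lemma subst_zV_laurent (p : {poly int}) (n : nat) :
  subst_zV (tofrac p / zvar ^+ n) = eval_at zvar^-1 p * zvar ^+ n.
Proof.
rewrite -tofracXn subst_zV_frac ?expf_neq0 ?polyX_eq0 //.
by rewrite {2}/eval_at map_polyXn hornerXn exprVn invrK tofracXn.
Qed.

(* Main.v *)
(* Since D N^T = N D and D N'^T = N' D, expanding A_+ D A_-^dagger gives
   (1 + z^2)(1 + z^-2) D - (z + z^-1)(N + N') D + N N' D, in which only the
   last term changes when N and N' are exchanged.  So the symmetry condition
   says N N' = N' N, that is A A' = A' A.  Condition (N4) can only fail at the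
   power z^1, where it reads n_ab n'_ab = 0; to extract it one needs that A_+
   and A_- determine N_0, N_+ and N_-. *)

Require Import Defs.
From mathcomp Require Import all_boot all_order all_fingroup all_algebra.
From mathcomp Require Import ring zify.

Import Order.TTheory GRing.Theory Num.Theory.

Local Open Scope ring_scope.

Lemma Qzmx_of_intE (r : nat) (M : 'M[int]_r) :
  Qzmx_of_int M = map_mx (@tofrac {poly int} \o polyC) M.
Proof. by rewrite /Qzmx_of_int /mx_of_poly /polymx_of_int -map_mx_comp. Qed.

Lemma Qzmx_of_intM (r : nat) (M M' : 'M[int]_r) :
  Qzmx_of_int (M *m M') = Qzmx_of_int M *m Qzmx_of_int M'.
Proof. by rewrite !Qzmx_of_intE map_mxM. Qed.

Lemma Qzmx_of_intD (r : nat) (M M' : 'M[int]_r) :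
  Qzmx_of_int (M + M') = Qzmx_of_int M + Qzmx_of_int M'.
Proof. by rewrite !Qzmx_of_intE map_mxD. Qed.

Lemma Qzmx_of_int_inj (r : nat) : injective (@Qzmx_of_int r).
Proof.
move=> M M' /matrixP e; apply/matrixP => a b; have := e a b.
by rewrite !mxE => /eqP; rewrite tofrac_eq => /eqP/polyC_inj.
Qed.

Lemma positive_diagonal_inj (r : nat) (D M M' : 'M[int]_r) :
  positive_diagonal D -> M *m D = M' *m D -> M = M'.
Proof.
move=> [/is_diag_mxP Ddiag Dpos] /matrixP e; apply/matrixP => a b.
have mulD (L : 'M[int]_r) : (L *m D) a b = L a b * D b b.
  rewrite mxE (bigD1 b) //= big1 ?addr0 // => c cb.
  by rewrite Ddiag ?mulr0.
by have := e a b; rewrite !mulD; apply/mulIf/lt0r_neq0.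
Qed.

(** The determinant is a product of positive integers, hence a nonzero element of the field Q(z). So
    [invmx] is here the true inverse and not its default value. *)
Lemma Qzmx_of_int_unit (r : nat) (D : 'M[int]_r) :
  positive_diagonal D -> Qzmx_of_int D \in unitmx.
Proof.
move=> [Ddiag Dpos]; rewrite unitmxE Qzmx_of_intE det_map_mx unitfE.
rewrite tofrac_eq0 polyC_eq0 det_trig ?is_diag_mx_is_trig //.
by apply/prodf_neq0 => a _; apply/lt0r_neq0.
Qed.

(** A diagonal D is its own transpose, so symmetry of A D reads D A^T = A D; the scalar matrix 2 I
    commutes with D. *)
Lemma symmetrizer_tr (r : nat) (A D : 'M[int]_r) :
  symmetrizer A D -> D *m (2%:M - A)^T = (2%:M - A) *m D.
Proof.
move=> [[/diag_mxP[d ->] _]]; rewrite trmx_mul tr_diag_mx => e.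
by rewrite linearB /= tr_scalar_mx mulmxBr mulmxBl e scalar_mxC.
Qed.

Lemma weak_GCM_ge0 (r : nat) (A : 'M[int]_r) (a b : 'I_r) :
  symmetrizable_weak_GCM A -> 0 <= (2%:M - A) a b.
Proof.
move=> [Adiag Aoff _]; rewrite !mxE; have [<-|ab] := eqVneq a b.
  by rewrite mulr1n subr_ge0 Adiag.
by rewrite mulr0n sub0r oppr_ge0 Aoff.
Qed.

(** The two shifted products exceed A A' and A' A by the same matrix 4 I - 2 A - 2 A'. *)
Lemma commute_shift (r : nat) (A A' : 'M[int]_r) :
  (2%:M - A) *m (2%:M - A') = (2%:M - A') *m (2%:M - A) <->
  A *m A' = A' *m A.
Proof.
rewrite !mulmxBl !mulmxBr !mul_scalar_mx !mul_mx_scalar.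
rewrite !opprB !addrA ![_ + _ *m _ - _]addrAC.
rewrite [X in X + A *m A' = _]addrAC.
by split=> [/addrI|->].
Qed.

Lemma coef_polymx (r : nat) (M : 'M[int]_r) (a b : 'I_r) (p : nat) :
  (('X *: polymx_of_int M) a b)`_p = (p == 1%N)%:R * M a b.
Proof.
by rewrite !mxE coefXM coefC; case: p => [|[|p]]; rewrite /= ?mul0r ?mul1r.
Qed.

(** The right-hand side has the shape of (N1) for the identity permutation and p_a = 2, ready for a
    termwise comparison. *)
Lemma coef_1DX2 (r : nat) (a b : 'I_r) (p : nat) :
  (((1 + 'X^2)%:M : 'M[{poly int}]_r) a b)`_p =
  (a == b)%:R * (p == 0%N)%:R + (a == b)%:R * (p == 2%N)%:R.
Proof.
by rewrite !mxE; case: eqP => _; rewrite ?mulr1n ?mulr0n ?coef0 ?mul0r ?addr0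
  // coefD coef1 coefXn !mul1r.
Qed.

Lemma coef_subr (r : nat) (P Q : 'M[{poly int}]_r) (a b : 'I_r) (p : nat) :
  ((P - Q) a b)`_p = (P a b)`_p - (Q a b)`_p.
Proof. by rewrite [(P - Q) a b]mxE [(- Q) a b]mxE coefB. Qed.

(* For b = sigma^-1(a) the coefficient of z^(p_a) in the (a,b) entry of
   A_+ is 1; as M is nonnegative, this forces p_a = 2 and sigma(a) = a. *)
Lemma conditions_N_unique (r : nat) (M : 'M[int]_r)
    (N0 Np Nm : 'M[{poly int}]_r) :
  (forall a b, 0 <= M a b) -> conditions_N N0 Np Nm ->
  (1 + 'X^2)%:M - 'X *: polymx_of_int M = N0 - Np -> N0 = (1 + 'X^2)%:M.
Proof.
move=> M0 [s [d [[dpos N0E] _ [NpE _] _]]] e.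
have sd a : s a = a /\ d a = 2%N.
  pose b := (s^-1%g) a; have sb : s b = a by rewrite permKV.
  have := congr1 (fun P : 'M[{poly int}]_r => (P a b)`_(d a)) e.
  rewrite !coef_subr coef_1DX2 coef_polymx N0E NpE ?ltnn ?andbF //.
  rewrite sb !eqxx -[d a == 0%N]negbK -lt0n dpos /= !mulr0 !add0r mulr1 subr0.
  (* Since (N3) kills [Np] at p = d a, the equation now reads [a = b][d a = 2] - [d a = 1] M_ab =
     1. *)
  have [d1|d1] := eqVneq (d a) 1%N.
    by rewrite d1 mulr0 mul1r => h; have := M0 a b; lia.
  have [ab|ab] := eqVneq a b; last by rewrite !mul0r subr0.
  have [->|d2] := eqVneq (d a) 2%N; last by rewrite !mulr0 mul0r subr0.
  by move=> _; split; rewrite // {1}ab.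
apply/matrixP => a b; apply/polyP => p.
by rewrite N0E coef_1DX2 (sd b).1 (sd a).2.
Qed.

Lemma mx_of_poly_pencil (r : nat) (M : 'M[int]_r) :
  mx_of_poly ((1 + 'X^2)%:M - 'X *: polymx_of_int M) =
  (1 + zvar ^+ 2)%:M - zvar *: Qzmx_of_int M.
Proof.
apply/matrixP => a b; rewrite !mxE rmorphB rmorphM rmorphMn rmorphD rmorph1.
by rewrite rmorphXn.
Qed.

(** The multiplicity n stands for the Kronecker delta in the entries of a scalar matrix. *)
Lemma horner_intr_pencil (F : comNzRingType) (f : F) (n : nat) (c : int) :
  (map_poly (fun c : int => c%:~R : F) ((1 + 'X^2) *+ n - 'X * c%:P)).[f] =
  (1 + f ^+ 2) *+ n - f * c%:~R.
Proof.
rewrite rmorphB rmorphM rmorphMn rmorphD rmorph1 /= map_polyXn map_polyX.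
by rewrite map_polyC !hornerE hornerMn !hornerE.
Qed.

Lemma dagger_pencil (r : nat) (M : 'M[int]_r) :
  dagger (mx_of_poly ((1 + 'X^2)%:M - 'X *: polymx_of_int M)) =
  (1 + zvar^-1 ^+ 2)%:M - zvar^-1 *: Qzmx_of_int M^T.
Proof.
apply/matrixP => a b; rewrite !mxE subst_zV_poly /eval_at.
by rewrite horner_intr_pencil intr_tofrac eq_sym.
Qed.

(** Both cross terms get the same factor, as (1 + z^2) z^-1 = z (1 + z^-2) = z + z^-1; so they
    involve M and M' only through M + M'. *)
Lemma mul_pencils (F : fieldType) (r : nat) (z : F) (M M' D : 'M[F]_r) :
  z != 0 -> D *m M'^T = M' *m D ->
  ((1 + z ^+ 2)%:M - z *: M) *m D *m ((1 + z^-1 ^+ 2)%:M - z^-1 *: M'^T) =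
  ((1 + z ^+ 2) * (1 + z^-1 ^+ 2)) *: D - (z + z^-1) *: ((M + M') *m D)
    + M *m M' *m D.
Proof.
move=> z0 DM'.
rewrite mulmxBr mul_mx_scalar -scalemxAr -(mulmxA _ D) DM' !mulmxBl.
rewrite !mul_scalar_mx -!scalemxAl mulmxA mulmxDl.
apply/matrixP => a b; rewrite !mxE; field.
exact: z0.
Qed.

Lemma pencil_product (r : nat) (M M' D : 'M[int]_r) :
  D *m M'^T = M' *m D ->
  mx_of_poly ((1 + 'X^2)%:M - 'X *: polymx_of_int M) *m Qzmx_of_int D
    *m dagger (mx_of_poly ((1 + 'X^2)%:M - 'X *: polymx_of_int M')) =
  ((1 + zvar ^+ 2) * (1 + zvar^-1 ^+ 2)) *: Qzmx_of_int D
    - (zvar + zvar^-1) *: Qzmx_of_int ((M + M') *m D)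
    + Qzmx_of_int (M *m M' *m D).
Proof.
move=> DM'; rewrite mx_of_poly_pencil dagger_pencil.
have -> : Qzmx_of_int M'^T = (Qzmx_of_int M')^T.
  by rewrite !Qzmx_of_intE map_trmx.
rewrite mul_pencils ?zvar_neq0 ?Qzmx_of_intM ?Qzmx_of_intD //.
by rewrite !Qzmx_of_intE map_trmx -!map_mxM DM'.
Qed.

Lemma dagger_symmetric_pencils (r : nat) (M M' D : 'M[int]_r) :
  positive_diagonal D -> D *m M^T = M *m D -> D *m M'^T = M' *m D ->
  mx_of_poly ((1 + 'X^2)%:M - 'X *: polymx_of_int M) *m Qzmx_of_int D
    *m dagger (mx_of_poly ((1 + 'X^2)%:M - 'X *: polymx_of_int M')) =
  mx_of_poly ((1 + 'X^2)%:M - 'X *: polymx_of_int M') *m Qzmx_of_int D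
    *m dagger (mx_of_poly ((1 + 'X^2)%:M - 'X *: polymx_of_int M)) <->
  M *m M' = M' *m M.
Proof.
move=> Dpos DM DM'; rewrite !pencil_product // (addrC M').
(* The terms symmetric in M and M' cancel, leaving M M' D = M' M D over the integers, where D
   cancels too. *)
split=> [/addrI/Qzmx_of_int_inj|->] //; exact: positive_diagonal_inj.
Qed.

(** Conjugation by D is transposition here: D M^T = M D gives D^-1 M D = M^T, which is integral. *)
Lemma conj_symmetrizable_poly (r : nat) (M D : 'M[int]_r) :
  positive_diagonal D -> D *m M^T = M *m D ->
  has_poly_entries (invmx (Qzmx_of_int D)
    *m mx_of_poly ('X *: polymx_of_int M) *m Qzmx_of_int D).
Proof.
move=> Dpos DM; exists ('X *: polymx_of_int M^T).
have E L : mx_of_poly ('X *: polymx_of_int L) = zvar *: Qzmx_of_int L :> 'M_r.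
  by apply/matrixP => a b; rewrite !mxE rmorphM.
rewrite !E -mulmxA -scalemxAl -Qzmx_of_intM -DM Qzmx_of_intM -scalemxAr.
by rewrite mulKmx // Qzmx_of_int_unit.
Qed.

Lemma conditions_N_pencil (r : nat) (M M' : 'M[int]_r) :
  (forall a b, 0 <= M a b) -> (forall a b, 0 <= M' a b) ->
  (forall a b, M a b * M' a b = 0) ->
  conditions_N (1 + 'X^2)%:M ('X *: polymx_of_int M) ('X *: polymx_of_int M').
Proof.
(* With p_a = 2, (N3) leaves only the power z^1, the one carried by z M and z M'. *)
move=> M0 M'0 MM'; exists 1%g, (fun=> 2%N); split.
- by split=> // a b p; rewrite coef_1DX2 perm1.
- by split=> a b p; rewrite coef_polymx mulr_ge0.
- by split=> a b [|[|p]] // _; rewrite coef_polymx mul0r.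
- by move=> a b p; rewrite !coef_polymx mulrACA MM' mulr0.
Qed.

Theorem proposition4p4 (r : nat) (A A' D : 'M[int]_r)
    (hA : symmetrizable_weak_GCM A) (hA' : symmetrizable_weak_GCM A')
    (hD : symmetrizer A D) (hD' : symmetrizer A' D) :
  let N : 'M[int]_r := 2%:M - A in
  let N' : 'M[int]_r := 2%:M - A' in
  let N0 : 'M[{poly int}]_r := (1 + 'X^2)%:M in
  let Np : 'M[{poly int}]_r := 'X *: polymx_of_int N in
  let Nm : 'M[{poly int}]_r := 'X *: polymx_of_int N' in
  is_T_datum (N0 - Np, N0 - Nm, D) <->
  (A *m A' = A' *m A /\ forall a b : 'I_r, N a b * N' a b = 0).
Proof.
move=> N N' N0 Np Nm.
have Dpos := hD.1; have DN := symmetrizer_tr _ _ _ hD.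
have DN' := symmetrizer_tr _ _ _ hD'.
have N_ge0 a b : 0 <= N a b := weak_GCM_ge0 _ _ a b hA.
have N'_ge0 a b : 0 <= N' a b := weak_GCM_ge0 _ _ a b hA'.
split=> [[Q0 [Qp [Qm [[cN Ap Am] [_ _ _ _ comm]]]]]|[comm NN']].
  split.
    exact/commute_shift/(dagger_symmetric_pencils _ _ _ _ Dpos DN DN').
  (* The decomposition provided by the T-datum is a priori another one; it must be identified with
     [N0], [Np], [Nm] before (N4) at p = 1 speaks about N and N'. *)
  have Q0E := conditions_N_unique _ _ _ _ _ N_ge0 cN Ap.
  move: Ap Am cN; rewrite Q0E => /addrI/oppr_inj <- /addrI/oppr_inj <-.
  move=> [s [d [_ _ _ N4]]] a b.
  by have := N4 a b 1%N; rewrite !coef_polymx !mul1r.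
exists N0, Np, Nm; split; first by split=> //; apply: conditions_N_pencil.
split.
- exact: Dpos.
- by rewrite scalar_mxC.
- exact: conj_symmetrizable_poly.
- exact: conj_symmetrizable_poly.
- exact/dagger_symmetric_pencils/commute_shift.
Qed.
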